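(* Let $\mathbf{Q}$ be a real $m\times n$ matrix with orthonormal rows, $\mathbf{Q}\mathbf{Q}^T=\mathbf{I}_m$, and coherence $\mu$, and let $\mathbf{Q}\mathbf{S}$ be computed by the sampling algorithm (described in the context) with $c$ samples. Given $0<\epsilon<1$ and $0<\delta<1$, we have $\sigma_m(\mathbf{Q}\mathbf{S})\geq\sqrt{1-\epsilon}$ with probability at least $1-\delta$, if the algorithm (i) either samples with ``nearly optimal'' probabilities $p_j^{\beta}$, where $0<\beta\leq 1$, $\sum_{j=1}^n p_j^{\beta}=1$ and $p_j^{\beta}\geq\beta\,\|Q_j\|_2^2/\|\mathbf{Q}\|_F^2$ for $1\leq j\leq n$, and $$c\geq c_0(\epsilon)\,m\,\frac{\ln(m/\delta)}{\beta\,\epsilon^2},$$ (ii) or samples with uniform probabilities $p_j=1/n$, $1\leq j\leq n$, and $$c\geq c_0(\epsilon)\,n\,\mu\,\frac{\ln(m/\delta)}{\epsilon^2}.$$ Here $c_0(\epsilon)\equiv 2+\tfrac{2}{3}\epsilon$.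
   Context: $Q_1,\ldots,Q_n$ are the columns of $\mathbf{Q}$; the coherence of $\mathbf{Q}$ is $\mu\equiv\max_{1\leq j\leq n}\|Q_j\|_2^2$. $\sigma_m(\mathbf{Q}\mathbf{S})$ denotes the $m$-th largest singular value of the $m\times c$ matrix $\mathbf{Q}\mathbf{S}$, i.e. the square root of the smallest eigenvalue of $(\mathbf{Q}\mathbf{S})(\mathbf{Q}\mathbf{S})^T$. $\|\cdot\|_2$ is the two-norm and $\|\cdot\|_F$ the Frobenius norm. Sampling algorithm: given $\mathbf{Q}$, a number of samples $1\leq c\leq n$ and probabilities $p_j\geq 0$ with $\sum_{j=1}^n p_j=1$, sample indices $t_1,\ldots,t_c$ from $\{1,\ldots,n\}$ independently and with replacement, with $\mathbb{P}[t_j=i]=p_i$; let $\mathbf{S}$ be the $n\times c$ matrix with columns $e_{t_j}/\sqrt{c\,p_{t_j}}$, where $e_i$ are the columns of $\mathbf{I}_n$. An index $i$ with $p_i=0$ is never selected. *)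

(* Defs.v *)
From HB Require Import structures.
From mathcomp Require Import all_boot all_order all_algebra.
From mathcomp Require Import all_classical all_reals all_analysis.

Set Implicit Arguments.
Unset Strict Implicit.
Unset Printing Implicit Defensive.

Import Order.TTheory GRing.Theory Num.Theory.
Import numFieldNormedType.Exports.

Local Open Scope classical_set_scope.
Local Open Scope ring_scope.

(* MathComp-Analysis's `|A| on matrices is the entrywise maximum, hence the
   Euclidean and Frobenius norms below. *)
Definition norm2 (R : realType) (m : nat) (v : 'cV[R]_m) : R :=
  Num.sqrt (\sum_(i < m) v i 0 ^+ 2).

Definition normF (R : realType) (m n : nat) (A : 'M[R]_(m, n)) : R :=
  Num.sqrt (\sum_(i < m) \sum_(j < n) A i j ^+ 2).

(* The default value 0 of the maximum is harmless: squared norms are >= 0. *)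
Definition coherence (R : realType) (m n : nat) (Q : 'M[R]_(m, n)) : R :=
  \big[Num.max/0]_(j < n) norm2 (col j Q) ^+ 2.

(* The m-th largest singular value of an m x c matrix.  For m > 0 the symmetric
   matrix A *m A^T has a nonempty finite set of (real) eigenvalues, so that the
   infimum is a minimum.  It is 0 when c < m. *)
Definition sigma_m (R : realType) (m c : nat) (A : 'M[R]_(m, c)) : R :=
  Num.sqrt (inf [set a : R | eigenvalue (A *m A^T) a]).

(* Column j is e_(t j) / sqrt (c * p_(t j)); it is 0 when p (t j) = 0, which
   has probability 0 under iid_samples. *)
Definition sampling_mx (R : realType) (n c : nat) (p : 'I_n -> R)
    (t : 'I_c -> 'I_n) : 'M[R]_(n, c) :=
  \matrix_(i < n, j < c) ((i == t j)%:R / Num.sqrt (c%:R * p (t j))).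

Definition probability_vector (R : realType) (n : nat) (p : 'I_n -> R) : Prop :=
  (forall j, 0 <= p j) /\ \sum_(j < n) p j = 1.

(* 'I_n carries no measurableType structure in the library; it is regarded here
   as a discrete space. *)
Definition index_rv (d : measure_display) (T : measurableType d) (n : nat)
    (X : T -> 'I_n) : Prop :=
  forall B : set 'I_n, measurable (X @^-1` B).

Definition mutually_independent (R : realType) (d : measure_display)
    (T : measurableType d) (P : probability T R) (n c : nat)
    (t : 'I_c -> T -> 'I_n) : Prop :=
  forall (J : {set 'I_c}) (B : 'I_c -> set 'I_n),
    P (\bigcap_(j in [set` J]) (t j @^-1` B j)) =
    (\prod_(j in J) P (t j @^-1` B j))%E.

Definition iid_samples (R : realType) (d : measure_display)
    (T : measurableType d) (P : probability T R) (n c : nat)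
    (p : 'I_n -> R) (t : 'I_c -> T -> 'I_n) : Prop :=
  [/\ forall j, index_rv (t j),
      mutually_independent P t &
      forall j i, P (t j @^-1` [set i]) = (p i)%:E].

Definition nearly_optimal (R : realType) (m n : nat) (Q : 'M[R]_(m, n))
    (beta : R) (p : 'I_n -> R) : Prop :=
  forall j, beta * (norm2 (col j Q) ^+ 2 / normF Q ^+ 2) <= p j.

Definition c0 (R : realType) (eps : R) : R := 2 + 2 / 3 * eps.

(* Main.v *)
Require Import Defs.
From HB Require Import structures.
From mathcomp Require Import all_boot all_order all_algebra.
From mathcomp Require Import all_classical all_reals all_analysis.
From mathcomp Require Import ring lra.
From mathcomp.real_closed Require Import complex.

Import Order.TTheory GRing.Theory Num.Theory.
Import numFieldNormedType.Exports.

Local Open Scope classical_set_scope.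
Local Open Scope ring_scope.

(** Why the theorem is true.  Write x_i for the i-th column of Q divided by
    sqrt (c * p_i), as a row vector.  The Gram matrix of the sample f is
    G = \sum_j x_(f j)^T x_(f j), and both sampling schemes give
    |x_i|^2 <= L := ell / c, where ell is m / beta or n * coherence Q, together
    with \sum_i p_i x_i^T x_i = (1 / c) I.  The claim is the lower tail of the
    matrix Chernoff inequality: with probability at least 1 - delta no
    eigenvalue of G lies below 1 - eps.

    The usual proof bounds E tr exp (- theta G) through the Golden--Thompson
    inequality.  Here the exponential is replaced by its finite approximation
    (I - h G)^K, with h = theta / K and K even, for which everything is
    elementary algebra.  Each sample subtracts a matrix of rank one, and the key
    estimate [mxtrace_exp_downdate_le] says that, for B positive definite and
    B' = B - h x^T x positive semidefinite,
      tr B'^K <= tr B^K - h K (x B^(K-1) x^T)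
                 + h^2 (K (K-1) / 2) |x|^2 (x B^(K-2) x^T).
    It follows from log-convexity of i |-> x B^i x^T, by trading the factors of
    B^K for B' one at a time.  Averaging over i turns the quadratic forms into
    traces, since the mean outer product is scalar, and each sample multiplies
    the expected trace by about exp (- (theta - theta^2 L / 2) / c)
    ([averaged_downdate_le], [expected_mxtrace_exp_le]).

    An eigenvalue of G below 1 - eps forces tr (I - h G)^K above
    (1 - h (1 - eps))^K, which is about exp (- theta (1 - eps)), so Markov's
    inequality bounds the probability of failure by about
    m exp (- theta eps + theta^2 L / 2) = m exp (- eps^2 / (2 L)) at
    theta = eps / L.  The term 2 eps / 3 of c0 leaves room for
    the error of replacing the exponential by a K-th power, K being large
    ([sampled_gram_low_eigenvalue_le]).  The passage from P to sums over outcomes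
    is [probability_outcome]. *)

Set Implicit Arguments.
Unset Strict Implicit.
Unset Printing Implicit Defensive.

(** * Quadratic forms and powers of positive semidefinite matrices *)

Definition bform {R : pzRingType} {n : nat} (A : 'M[R]_n) (x y : 'rV[R]_n) : R :=
  (x *m A *m y^T) 0 0.

(** Symmetry is part of positive semidefiniteness, because a quadratic form only
    sees the symmetric part of its matrix. *)
Definition psd {R : realFieldType} {n : nat} (A : 'M[R]_n) : Prop :=
  A^T = A /\ forall x, 0 <= bform A x x.

Section Forms.
Context {R : realFieldType} {n : nat}.
Implicit Types (A B : 'M[R]_n) (x y z : 'rV[R]_n).

Lemma bformDl A x y z : bform A (x + y) z = bform A x z + bform A y z.
Proof. by rewrite /bform !mulmxDl mxE. Qed.

Lemma bformDr A x y z : bform A x (y + z) = bform A x y + bform A x z.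
Proof. by rewrite /bform linearD mulmxDr mxE. Qed.

Lemma bformZl A a x y : bform A (a *: x) y = a * bform A x y.
Proof. by rewrite /bform -!scalemxAl mxE. Qed.

Lemma bformZr A a x y : bform A x (a *: y) = a * bform A x y.
Proof. by rewrite /bform linearZ /= -scalemxAr mxE. Qed.

Lemma bform_addmx A B x y : bform (A + B) x y = bform A x y + bform B x y.
Proof. by rewrite /bform mulmxDr mulmxDl mxE. Qed.

Lemma bform_scalemx a A x y : bform (a *: A) x y = a * bform A x y.
Proof. by rewrite /bform -scalemxAr -scalemxAl mxE. Qed.

Lemma bform_submx A B x y : bform (A - B) x y = bform A x y - bform B x y.
Proof. by rewrite -scaleN1r bform_addmx bform_scalemx mulN1r. Qed.

Lemma bform_tr A x y : bform A^T x y = bform A y x.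
Proof.
rewrite /bform -[x *m _ *m _]trmxK [LHS]mxE.
by rewrite !trmx_mul !trmxK mulmxA.
Qed.

Lemma bform_mul_outer A B x y z w :
  bform (A * (y^T *m z) * B) x w = bform A x y * bform B z w.
Proof.
rewrite /bform; have -> : x *m (A * (y^T *m z) * B) *m w^T =
  (x *m A *m y^T) *m (z *m B *m w^T) by rewrite -!mulmxE !mulmxA.
by rewrite [LHS]mxE big_ord1.
Qed.

Lemma mxtrace_mul_outer A B x y :
  \tr (A * (x^T *m y) * B) = bform (B * A) y x.
Proof.
rewrite /bform -!mulmxE mulmxA -[_ *m y *m B]mulmxA mxtrace_mulC !mulmxA.
by rewrite [LHS]/mxtrace big_ord1.
Qed.

Lemma mxtrace_sum_bform A : \tr A = \sum_i bform A (delta_mx 0 i) (delta_mx 0 i).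
Proof.
apply: eq_bigr => i _; rewrite /bform -rowE trmx_delta.
by rewrite -colE !mxE.
Qed.

Lemma bform1_sumsq x : bform 1%:M x x = \sum_i x 0 i ^+ 2.
Proof. by rewrite /bform mulmx1 mxE; apply: eq_bigr => i _; rewrite mxE -expr2. Qed.

Lemma bform1_gt0 x : x != 0 -> 0 < bform 1%:M x x.
Proof.
move=> x0.
rewrite bform1_sumsq lt_neqAle sumr_ge0 ?andbT => [|l _]; last exact: sqr_ge0.
apply: contraNneq x0 => /esym/eqP.
rewrite psumr_eq0 => [/allP xi0|l _]; last exact: sqr_ge0.
apply/eqP/rowP => l; rewrite mxE; apply/eqP.
by rewrite -sqrf_eq0; apply: xi0; rewrite mem_index_enum.
Qed.

Lemma bform_outer x y : bform (x^T *m x) y y = bform 1%:M y x ^+ 2.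
Proof.
have := bform_mul_outer 1%:M 1%:M y x x y.
rewrite -!mulmxE mul1mx mulmx1 => ->; rewrite expr2; congr (_ * _).
by rewrite -bform_tr trmx1.
Qed.

(** Cauchy--Schwarz for a possibly degenerate form.  If y A y^T > 0, the form at
    (y A y^T) x - (x A y^T) y is y A y^T times the difference of the two sides.
    If y A y^T = 0, the form is affine along the direction y and bounded below,
    hence constant. *)
Lemma psd_cauchy_schwarz A x y : psd A ->
  bform A x y ^+ 2 <= bform A x x * bform A y y.
Proof.
move=> [symA posA].
have syA : bform A y x = bform A x y by rewrite -bform_tr symA.
have expand a b : bform A (a *: x + b *: y) (a *: x + b *: y) =
    a ^+ 2 * bform A x x + 2 * a * b * bform A x y + b ^+ 2 * bform A y y.
  by rewrite !(bformDl, bformDr, bformZl, bformZr) syA; ring.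
have qy := posA y; have qx := posA x.
case: (eqVneq (bform A y y) 0) => [y0|ny0].
  have [->|nz] := eqVneq (bform A x y) 0; first by rewrite expr0n mulr_ge0.
  (* This coefficient makes the form equal to -1. *)
  have := posA (1 *: x + (- (bform A x x + 1) / (2 * bform A x y)) *: y).
  rewrite expand y0.
  set u := bform A x x; set v := bform A x y in nz *.
  have -> : 1 ^+ 2 * u + 2 * 1 * (- (u + 1) / (2 * v)) * v +
    (- (u + 1) / (2 * v)) ^+ 2 * 0 = -1 by field.
  by rewrite oppr_ge0 ler10.
have qy0 : 0 < bform A y y by rewrite lt_neqAle eq_sym ny0.
have := posA (bform A y y *: x + (- bform A x y) *: y); rewrite expand.
set u := bform A x x; set v := bform A x y; set w := bform A y y in qy0 *.
have -> : w ^+ 2 * u + 2 * w * (- v) * v + (- v) ^+ 2 * w =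
  w * (u * w - v ^+ 2) by ring.
by rewrite pmulr_rge0 // subr_ge0.
Qed.

End Forms.

Section PowersOfPsd.
Context {R : realFieldType} {n : nat}.
Implicit Types (A B : 'M[R]_n) (x y z : 'rV[R]_n).

Lemma psd1 : psd (1%:M : 'M[R]_n).
Proof.
split=> [|x]; first exact: trmx1.
by rewrite bform1_sumsq sumr_ge0 // => i _; rewrite sqr_ge0.
Qed.

Lemma trmx_exp A k : (A ^+ k)^T = A^T ^+ k.
Proof.
elim: k => [|k IH]; first exact: trmx1.
by rewrite exprSr -mulmxE trmx_mul IH exprS mulmxE.
Qed.

Lemma bform_sandwich A B x : A^T = A ->
  bform (A * B * A) x x = bform B (x *m A) (x *m A).
Proof. by move=> symA; rewrite /bform trmx_mul symA -!mulmxE !mulmxA. Qed.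

Lemma bform_sandwich_exp A B j x : A^T = A ->
  bform (A ^+ j * B * A ^+ j) x x = bform B (x *m A ^+ j) (x *m A ^+ j).
Proof. by move=> symA; rewrite bform_sandwich // trmx_exp symA. Qed.

(** With j = k./2, A^k is A^j A A^j or A^j A^j, so its form at x is that of A or
    of the identity at x A^j. *)
Lemma psdX A k : psd A -> psd (A ^+ k).
Proof.
move=> [symA posA]; split=> [|x]; first by rewrite trmx_exp symA.
rewrite -(odd_double_half k) -addnn; set j := k./2.
case: (odd k); rewrite ?add0n.
  rewrite add1n exprSr exprD -mulrA -exprSr exprS mulrA.
  by rewrite bform_sandwich_exp //; exact: posA.
have -> : A ^+ (j + j) = A ^+ j * 1%:M * A ^+ j by rewrite mulr1 -exprD.
by rewrite bform_sandwich_exp //; exact: (psd1).2.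
Qed.

(** Cauchy--Schwarz for the form of A^k at the vectors x and x A. *)
Lemma bform_expS_sqr_le A k x : psd A ->
  bform (A ^+ k.+1) x x ^+ 2 <= bform (A ^+ k) x x * bform (A ^+ k.+2) x x.
Proof.
move=> psdA; have symA := psdA.1.
have -> : bform (A ^+ k.+1) x x = bform (A ^+ k) x (x *m A).
  by rewrite /bform trmx_mul symA exprSr -!mulmxE !mulmxA.
have -> : bform (A ^+ k.+2) x x = bform (A ^+ k) (x *m A) (x *m A).
  by rewrite exprSr exprS bform_sandwich.
by apply: psd_cauchy_schwarz; exact: psdX.
Qed.

End PowersOfPsd.

(** Log-convexity makes the ratios u (k+1) / u k nondecreasing, so increasing an
    index by one is worth more at i + j than at j. *)
Lemma log_convex_mul_le (R : realFieldType) (u : nat -> R) :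
  (forall i, 0 < u i) -> (forall i, u i.+1 ^+ 2 <= u i * u i.+2) ->
  forall i j, u i * u j <= u 0%N * u (i + j)%N.
Proof.
move=> u0 uc.
have ratio k l : u l.+1 / u l <= u (k + l).+1 / u (k + l)%N.
  elim: k => [|k IH]; first by rewrite add0n.
  apply: le_trans IH _; rewrite ler_pdivrMr // mulrAC ler_pdivlMr // -expr2.
  by rewrite mulrC; exact: uc.
move=> i; elim=> [|j IH]; first by rewrite addn0 mulrC.
have e k : u k.+1 = u k * (u k.+1 / u k) by rewrite mulrCA divff ?mulr1 // gt_eqF.
rewrite addnS (e j) (e (i + j)%N) [u i * _]mulrA [u 0%N * _]mulrA.
apply: (ler_pM _ _ IH (ratio i j)).
  by rewrite mulr_ge0 // ltW.
by rewrite divr_ge0 // ltW.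
Qed.

(** * Trace of a power after subtracting a matrix of rank one *)

Section RankOneDowndate.
Context {R : realFieldType} {n : nat}.
Context {B B' : 'M[R]_n} {x : 'rV[R]_n} {h b : R}.
Context (psdB : psd B) (psdB' : psd B') (h_ge0 : 0 <= h) (b_gt0 : 0 < b).
Context (B_ge : forall y, b * bform 1%:M y y <= bform B y y).
Context (defB' : B' = B - h *: (x^T *m x)).

(** The lower bound b on B keeps all these values positive for x nonzero, as
    the ratios in the log-convexity argument require. *)
Lemma bform_exp_mul_le i j :
  bform (B ^+ i) x x * bform (B ^+ j) x x <=
  bform 1%:M x x * bform (B ^+ (i + j)) x x.
Proof.
have [->|x0] := eqVneq x 0.
  by rewrite /bform !mul0mx !mxE !mul0r.
apply: (@log_convex_mul_le R (fun i => bform (B ^+ i) x x)) => [k|k]; last first.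
  exact: bform_expS_sqr_le.
have x_gt0 := bform1_gt0 x0.
suff : 0 < bform (B ^+ k) x x /\ 0 < bform (B ^+ k.+1) x x by case.
elim: k => [|k [IH1 IH2]].
  split=> //; rewrite expr1; apply: lt_le_trans (B_ge x); exact: mulr_gt0.
split=> //; rewrite -(pmulr_rgt0 _ IH1).
by apply: lt_le_trans (bform_expS_sqr_le k x psdB); rewrite exprn_gt0.
Qed.

Let phi i := bform (B ^+ i) x x.
Let mixed a i := bform (B ^+ a * B' ^+ i) x x.

(** Exchanging one factor B for B' costs a product of two scalars, because
    B - B' has rank one.  The three bounds below iterate this exchange. *)
Let mixedS a i : mixed a i.+1 = mixed a.+1 i - h * (phi a * bform (B' ^+ i) x x).
Proof.
rewrite /mixed exprS {1}defB' mulrA mulrBr mulrBl -exprSr bform_submx.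
rewrite -!mulmxE -scalemxAr -scalemxAl !mulmxE bform_scalemx.
by rewrite bform_mul_outer.
Qed.

Let phi_ge0 i : 0 <= phi i. Proof. exact: (psdX i psdB).2. Qed.

Let mixed_le a i : mixed a i <= phi (a + i).
Proof.
elim: i a => [|i IH] a; first by rewrite /mixed mulr1 addn0.
rewrite mixedS addnS -addSn; apply: le_trans (IH a.+1).
by rewrite gerBl !mulr_ge0 //; exact: (psdX i psdB').2.
Qed.

(** The i-th exchange costs at most h * phi 0 * phi s: bound the power of B' by
    that of B, then merge the two exponents by log-convexity. *)
Let mixed_ge s a i : (a + i)%N = s.+1 ->
  phi s.+1 - h * i%:R * (phi 0 * phi s) <= mixed a i.
Proof.
elim: i a => [|i IH] a; first by rewrite addn0 => ->; rewrite /mixed mulr1 /phi; lra.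
rewrite addnS -addSn mixedS => ai; have := IH _ ai.
have asi : (a + i)%N = s by move: ai; rewrite addSn => -[].
suff : h * (phi a * bform (B' ^+ i) x x) <= h * (phi 0 * phi s).
  by rewrite -natr1; lra.
apply: ler_wpM2l => //; rewrite -asi.
apply: le_trans (bform_exp_mul_le a i); apply: ler_wpM2l => //.
by have := mixed_le 0 i; rewrite /mixed expr0 mul1r.
Qed.

(** The i-th exchange gains h * mixed _ (i - 1), which [mixed_ge] bounds below; the
    linear losses 0 + 1 + ... + (i - 1) add up to 'C(i, 2), whence the factor
    1 / 2 of the second-order term, on which the constant of the tail bound
    depends. *)
Let mxtrace_mixed_le s a i : (a + i)%N = s.+2 ->
  \tr (B ^+ a * B' ^+ i) <=
  \tr (B ^+ s.+2) - h * i%:R * phi s.+1 + h ^+ 2 * 'C(i, 2)%:R * (phi 0 * phi s).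
Proof.
elim: i a => [|i IH] a.
  by rewrite addn0 => ->; rewrite bin0n /= !mulr0n !mulr0 !mul0r subr0 addr0 mulr1.
rewrite addnS -addSn => ai; have IHi := IH _ ai.
have asi : (a + i)%N = s.+1 by move: ai; rewrite addSn => -[].
rewrite exprS {1}defB' mulrA mulrBr mulrBl -exprSr.
rewrite -!mulmxE -scalemxAr -scalemxAl !mulmxE linearB linearZ /= mxtrace_mul_outer.
have -> : bform (B' ^+ i * B ^+ a) x x = mixed a i.
  rewrite -bform_tr -mulmxE trmx_mul !trmx_exp psdB.1 psdB'.1.
  by rewrite mulmxE.
have := ler_wpM2l h_ge0 (mixed_ge asi).
move: IHi; rewrite binS bin1 natrD -natr1 /phi.
set u := \tr _; set v := \tr _.
lra.
Qed.

(** Substitute for Golden--Thompson: a second-order expansion of the trace, with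
    B' eliminated from the right-hand side. *)
Lemma mxtrace_exp_downdate_le s :
  \tr (B' ^+ s.+2) <=
  \tr (B ^+ s.+2) - h * s.+2%:R * bform (B ^+ s.+1) x x
  + h ^+ 2 * 'C(s.+2, 2)%:R * (bform 1%:M x x * bform (B ^+ s) x x).
Proof.
by have := @mxtrace_mixed_le s 0 s.+2 erefl; rewrite expr0 mul1r.
Qed.

End RankOneDowndate.

(** * Expected trace after independent samples *)

Section AveragedStep.
Context {R : realFieldType} {m n : nat}.
Context {p : 'I_n -> R} {x : 'I_n -> 'rV[R]_m} {L kappa h b : R}.
Context (p_ge0 : forall i, 0 <= p i) (p_sum : \sum_i p i = 1).
Context (x_le : forall i, bform 1%:M (x i) (x i) <= L).
Context (sum_outer : \sum_i p i *: ((x i)^T *m x i) = kappa%:M).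
Context (kappa_ge0 : 0 <= kappa) (h_ge0 : 0 <= h) (b_gt0 : 0 < b) (L_ge0 : 0 <= L).

Lemma sum_bform_outer B : \sum_i p i * bform B (x i) (x i) = kappa * \tr B.
Proof.
rewrite -mxtraceZ -mul_scalar_mx -sum_outer mulmx_suml linear_sum /=.
apply: eq_bigr => i _; rewrite -scalemxAl mxtraceZ; congr (_ * _).
have := mxtrace_mul_outer 1%:M B (x i) (x i).
by rewrite -!mulmxE mul1mx mulmx1 => ->.
Qed.

Lemma bform_outer_le i y : bform ((x i)^T *m x i) y y <= L * bform 1%:M y y.
Proof.
rewrite bform_outer; apply: le_trans (psd_cauchy_schwarz _ _ psd1) _.
by rewrite mulrC; apply: ler_wpM2r => //; exact: psd1.2.
Qed.

Lemma downdate_ge B a i y :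
  (a + h * L) * bform 1%:M y y <= bform B y y ->
  a * bform 1%:M y y <= bform (B - h *: ((x i)^T *m x i)) y y.
Proof.
move=> B_ge; rewrite bform_submx bform_scalemx.
by have := ler_wpM2l h_ge0 (bform_outer_le i y); lra.
Qed.

Lemma trmx_downdate B i :
  B^T = B -> (B - h *: ((x i)^T *m x i))^T = B - h *: ((x i)^T *m x i).
Proof. by move=> symB; rewrite linearB linearZ /= symB trmx_mul trmxK. Qed.

Section OneStep.
Context {B : 'M[R]_m} {k : nat} (psdB : psd B).
Context (B_le1 : forall y, bform B y y <= bform 1%:M y y).
Context (B_ge : forall y, b * bform 1%:M y y <= bform B y y).

(** The exponent is even so that B^(k+k) splits around the middle. *)
Lemma mxtrace_even_exp_le : b * \tr (B ^+ k.*2) <= \tr (B ^+ k.*2.+1).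
Proof.
rewrite !mxtrace_sum_bform mulr_sumr; apply: ler_sum => i _.
set y := delta_mx _ _; rewrite -addnn.
have -> : B ^+ (k + k) = B ^+ k * 1%:M * B ^+ k by rewrite mulr1 exprD.
have -> : B ^+ (k + k).+1 = B ^+ k * B * B ^+ k by rewrite -exprSr -exprD addSn.
rewrite !(bform_sandwich_exp _ _ _ psdB.1); exact: B_ge.
Qed.

Lemma mxtrace_odd_exp_le : \tr (B ^+ k.*2.+2) <= \tr (B ^+ k.*2.+1).
Proof.
rewrite -subr_ge0 -linearB /= mxtrace_sum_bform sumr_ge0 // => i _.
set y := delta_mx _ _; rewrite -addnn.
have sym1B : (1%:M - B)^T = 1%:M - B by rewrite linearB /= trmx1 psdB.1.
have -> : B ^+ (k + k).+1 - B ^+ (k + k).+2 = B ^+ k * (B - B * B) * B ^+ k.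
  rewrite mulrBr mulrBl !mulrA -!exprSr -!exprD !addSn.
  by [].
rewrite (bform_sandwich_exp _ _ _ psdB.1); set z := y *m _.
(* A sum of two congruences, of B by 1 - B and of 1 - B by B. *)
have -> : B - B * B = (1%:M - B) * B * (1%:M - B) + B * (1%:M - B) * B.
  rewrite !(mulrBl, mulrBr) !mul1r !mulr1.
  by rewrite ?mulrA ?subrK.
rewrite bform_addmx (bform_sandwich _ _ sym1B) (bform_sandwich _ _ psdB.1).
by rewrite addr_ge0 ?psdB.2 // bform_submx subr_ge0.
Qed.

Context (psd_down : forall i, psd (B - h *: ((x i)^T *m x i))).

(** Averaging [mxtrace_exp_downdate_le] turns x_i B^j x_i^T into kappa * tr B^j.
    The traces of the two lower powers are then compared with that of the top
    one through b <= B <= 1; the first hypothesis makes the net coefficient of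
    the odd trace nonpositive. *)
Lemma averaged_downdate_le (r : R) :
  h * 'C(k.*2.+2, 2)%:R * L <= b * k.*2.+2%:R ->
  1 - kappa * (h * k.*2.+2%:R - h ^+ 2 * 'C(k.*2.+2, 2)%:R * L / b) <= r ->
  \sum_i p i * \tr ((B - h *: ((x i)^T *m x i)) ^+ k.*2.+2) <=
  \tr (B ^+ k.*2.+2) * r.
Proof.
set K := k.*2.+2%:R; set C2 := 'C(_, _)%:R; move=> hC hr.
set T2 := \tr (B ^+ k.*2.+2); set T1 := \tr (B ^+ k.*2.+1).
set T0 := \tr (B ^+ k.*2).
have T21 : T2 <= T1 by exact: mxtrace_odd_exp_le.
have T01 : b * T0 <= T1 by exact: mxtrace_even_exp_le.
have T2_ge0 : 0 <= T2.
  by rewrite /T2 mxtrace_sum_bform sumr_ge0 // => i _; exact: (psdX _ psdB).2.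
have step i : p i * \tr ((B - h *: ((x i)^T *m x i)) ^+ k.*2.+2) <=
    p i * T2 - h * K * (p i * bform (B ^+ k.*2.+1) (x i) (x i))
    + h ^+ 2 * C2 * L * (p i * bform (B ^+ k.*2) (x i) (x i)).
  have := mxtrace_exp_downdate_le psdB (psd_down i) h_ge0 b_gt0 B_ge erefl k.*2.
  rewrite -/T2 -/K -/C2; set t := \tr _ => tle.
  set u := bform (B ^+ k.*2.+1) _ _ in tle *.
  have : bform 1%:M (x i) (x i) * bform (B ^+ k.*2) (x i) (x i) <=
         L * bform (B ^+ k.*2) (x i) (x i).
    by apply: ler_wpM2r => //; exact: (psdX _ psdB).2.
  have C2_ge0 : 0 <= h ^+ 2 * C2 by rewrite mulr_ge0 ?sqr_ge0 ?ler0n.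
  move/(ler_wpM2l C2_ge0) => le2.
  have {tle le2} := le_trans tle (lerD (lexx _) le2).
  by move/(ler_wpM2l (p_ge0 i)); lra.
apply: le_trans (ler_sum _ (fun i _ => step i)) _.
rewrite big_split /= sumrB -mulr_suml -!mulr_sumr !sum_bform_outer p_sum mul1r.
rewrite -/T0 -/T1.
have C2L_ge0 : 0 <= h ^+ 2 * C2 * (L * kappa) / b.
  by rewrite divr_ge0 ?(ltW b_gt0) // mulr_ge0 ?mulr_ge0 ?sqr_ge0 ?ler0n.
have T0' : h ^+ 2 * C2 * L * (kappa * T0) <= h ^+ 2 * C2 * (L * kappa) / b * T1.
  have -> : h ^+ 2 * C2 * L * (kappa * T0) = h ^+ 2 * C2 * (L * kappa) / b * (b * T0).
    by field; rewrite gt_eqF.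
  exact: ler_wpM2l.
apply: (@le_trans _ _ (T2 * (1 - kappa * (h * K - h ^+ 2 * C2 * L / b)))); last first.
  exact: ler_wpM2l.
have g_ge0 : 0 <= kappa * (h * K - h ^+ 2 * C2 * L / b).
  apply: mulr_ge0 => //; rewrite subr_ge0 ler_pdivrMr //.
  by have := ler_wpM2l h_ge0 hC; lra.
by have := ler_wpM2l g_ge0 T21; lra.
Qed.

End OneStep.

Lemma big_ffun_ordS (V : nmodType) (I : finType) (k : nat)
    (F : ('I_k.+1 -> I) -> V) :
  (forall f g, f =1 g -> F f = F g) ->
  \sum_(f : {ffun 'I_k.+1 -> I}) F f =
  \sum_(i : I) \sum_(g : {ffun 'I_k -> I})
     F (fun j => if unlift ord0 j is Some j' then g j' else i).
Proof.
move=> F_ext; rewrite pair_big /=.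
pose cons_ffun (u : I * {ffun 'I_k -> I}) : {ffun 'I_k.+1 -> I} :=
  [ffun j => if unlift ord0 j is Some j' then u.2 j' else u.1].
rewrite (reindex cons_ffun) /=.
  by apply: eq_bigr => -[i g] _; apply: F_ext => j; rewrite ffunE.
exists (fun f => (f ord0, [ffun j => f (lift ord0 j)])) => [[i g]|f] _.
  congr (_, _); first by rewrite ffunE unlift_none.
  by apply/ffunP => j; rewrite !ffunE liftK.
by apply/ffunP => j; rewrite ffunE; case: unliftP => [j'|] -> //=; rewrite ffunE.
Qed.

(** Induction on the number k of samples, drawing the first one and generalizing
    over the start B.  Each sample may lower the bottom of the spectrum by h * L,
    so B has to start at least k * (h * L) above b. *)
Lemma expected_mxtrace_exp_le (r : R) s k B : psd B -> 0 <= r ->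
  (forall y, bform B y y <= bform 1%:M y y) ->
  (forall y, (b + k%:R * (h * L)) * bform 1%:M y y <= bform B y y) ->
  h * 'C(s.*2.+2, 2)%:R * L <= b * s.*2.+2%:R ->
  1 - kappa * (h * s.*2.+2%:R - h ^+ 2 * 'C(s.*2.+2, 2)%:R * L / b) <= r ->
  \sum_(f : {ffun 'I_k -> 'I_n}) (\prod_j p (f j)) *
    \tr ((B - h *: \sum_j (x (f j))^T *m x (f j)) ^+ s.*2.+2) <=
  \tr (B ^+ s.*2.+2) * r ^+ k.
Proof.
move=> psdB r_ge0 + + hC hr; elim: k B psdB => [|k IH] B psdB B_le1 B_ge.
  rewrite (big_pred1 (ffun0 (card_ord 0))).
    by rewrite !big_ord0 scaler0 subr0 mul1r mulr1.
  by move=> f /=; apply/esym/eqP/ffunP => -[].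
have hL_ge0 : 0 <= h * L by exact: mulr_ge0.
have b_B y : b * bform 1%:M y y <= bform B y y.
  apply: le_trans (B_ge y); apply: ler_wpM2r; first exact: psd1.2.
  by rewrite lerDl mulr_ge0.
have down_ge i y : (b + k%:R * (h * L)) * bform 1%:M y y <=
    bform (B - h *: ((x i)^T *m x i)) y y.
  by apply: downdate_ge; have := B_ge y; rewrite -natr1; lra.
have down_psd i : psd (B - h *: ((x i)^T *m x i)).
  split=> [|y]; first exact: trmx_downdate psdB.1.
  apply: le_trans (down_ge i y); rewrite !mulr_ge0 ?psd1.2 //.
  by rewrite addr_ge0 ?mulr_ge0 // ltW.
rewrite (big_ffun_ordS (F := fun f => (\prod_j p (f j)) *
    \tr ((B - h *: \sum_j (x (f j))^T *m x (f j)) ^+ s.*2.+2))); last first.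
  move=> f g fg; congr (_ * \tr ((B - h *: _) ^+ _)).
    by apply: eq_bigr => j _; rewrite fg.
  by apply: eq_bigr => j _; rewrite fg.
apply: (@le_trans _ _ (\sum_i p i *
    \tr ((B - h *: ((x i)^T *m x i)) ^+ s.*2.+2) * r ^+ k)); last first.
  rewrite -mulr_suml (exprS r k) mulrA; apply: ler_wpM2r; first exact: exprn_ge0.
  exact: averaged_downdate_le.
apply: ler_sum => i _; rewrite -mulrA.
apply: le_trans (ler_wpM2l (p_ge0 i) (IH _ (down_psd i) _ (down_ge i))); last first.
  move=> y; apply: le_trans (B_le1 y).
  by rewrite bform_submx bform_scalemx bform_outer gerBl mulr_ge0 ?sqr_ge0.
rewrite mulr_sumr; apply: ler_sum => g _.
rewrite !big_ord_recl unlift_none mulrA /=.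
under eq_bigr do rewrite liftK.
under [in X in h *: (_ + X)]eq_bigr do rewrite liftK.
by rewrite scalerDr opprD addrA.
Qed.

End AveragedStep.

(** * Eigenvalues of symmetric matrices *)

(** Over the complex numbers there is an eigenvalue z with eigenvector v; evaluating
    v A v^* in two ways gives z |v|^2 = z^* |v|^2, so z is real. *)
Lemma real_eigenvalue_sym (R : rcfType) (m : nat) (A : 'M[R]_m) :
  (0 < m)%N -> A^T = A -> exists a, eigenvalue A a.
Proof.
move=> m_gt0 symA.
pose C : numClosedFieldType := complex.complex R.
pose toC : {rmorphism R -> C} := complex.real_complex R.
pose conj : {rmorphism C -> C} := @complex.conjc R.
have sz : size (map_poly toC (char_poly A)) != 1%N.
  by rewrite size_map_poly size_char_poly eqSS -lt0n.
have [z] := closed_rootP _ sz; rewrite map_char_poly -eigenvalue_root_char.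
case/eigenvalueP => v vA v_neq0; pose w := map_mx conj v.
have wA : w *m map_mx toC A = conj z *: w.
  rewrite -map_mxZ -vA map_mxM; congr (_ *m _); rewrite -map_mx_comp.
  by apply/matrixP => i j; rewrite !mxE; exact/esym/conjc_real.
have vAw : z *: (v *m w^T) = conj z *: (v *m w^T).
  have symA' : (map_mx toC A)^T = map_mx toC A.
    by rewrite -{2}symA; apply/matrixP => i j; rewrite !mxE.
  by rewrite scalemxAl -vA -mulmxA -{1}symA' -trmx_mul wA linearZ /= -scalemxAr.
have vw_neq0 : (v *m w^T) 0 0 != 0.
  rewrite mxE; under eq_bigr do rewrite !mxE.
  apply: contraNneq v_neq0 => /eqP; rewrite psumr_eq0 => [/allP v0|j _]; last first.
    exact: mulcJ_ge0.
  apply/eqP/rowP => j; rewrite mxE; have := v0 j (mem_index_enum j).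
  by rewrite /= mulf_eq0 conjc_eq0 orbb => /eqP.
have zJ : conj z = z.
  apply: (mulIf vw_neq0); move/matrixP/(_ 0 0): vAw; rewrite mxE => ->.
  by rewrite [RHS]mxE.
have {zJ} zE : toC (complex.Re z) = z.
  case: z zJ {vA wA vAw} => a b /= [] b0; congr (Complex _ _).
  by lra.
exists (complex.Re z); rewrite eigenvalue_root_char -(fmorph_root toC) map_char_poly.
rewrite zE -eigenvalue_root_char; apply/eigenvalueP; exists v => //.
Qed.

(** The Frobenius norm dominates the operator norm: Cauchy--Schwarz applied to each
    entry of v N. *)
Lemma bform1_mul_le (R : realFieldType) (m : nat) (N : 'M[R]_m) (v : 'rV[R]_m) :
  N^T = N -> bform 1%:M (v *m N) (v *m N) <= \tr (N * N) * bform 1%:M v v.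
Proof.
move=> symN; rewrite mulrC mxtrace_sum_bform mulr_sumr bform1_sumsq.
apply: ler_sum => j _; set e := delta_mx 0 j.
have -> : (v *m N) 0 j = bform 1%:M v (e *m N).
  by rewrite /bform mulmx1 trmx_mul symN mulmxA /e trmx_delta -colE [RHS]mxE.
have -> : N * N = N * 1%:M * N by rewrite mulr1.
by rewrite bform_sandwich //; exact: psd_cauchy_schwarz psd1.
Qed.

(** The power is even, so that it is the square of a symmetric matrix and its trace
    is a squared Frobenius norm. *)
Lemma eigenvalue_exp_le_mxtrace (R : realFieldType) (m k : nat) (A : 'M[R]_m)
    (a h : R) :
  A^T = A -> eigenvalue A a ->
  (1 - h * a) ^+ k.*2 <= \tr ((1%:M - h *: A) ^+ k.*2).
Proof.
move=> symA /eigenvalueP [v vA v_neq0]; set B := 1%:M - h *: A.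
have symB : B^T = B by rewrite linearB linearZ /= trmx1 symA.
have vB : v *m B = (1 - h * a) *: v.
  by rewrite mulmxBr mulmx1 -scalemxAr vA scalerA scalerBl scale1r.
have vBk : v *m B ^+ k = (1 - h * a) ^+ k *: v.
  elim: k => [|k IH]; first by rewrite !expr0 mulmx1 scale1r.
  by rewrite !exprS -mulmxE mulmxA vB -scalemxAl IH scalerA.
have symBk : (B ^+ k)^T = B ^+ k by rewrite trmx_exp symB.
have := bform1_mul_le v symBk; rewrite vBk bformZl bformZr mulrA -!exprD addnn.
by rewrite ler_pM2r // bform1_gt0.
Qed.


(** * Lower tail of the smallest eigenvalue *)

Section TailBound.
Context {R : realType} {m n c : nat}.
Context {p : 'I_n -> R} {x : 'I_n -> 'rV[R]_m} {L eps : R}.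
Context (p_ge0 : forall i, 0 <= p i) (p_sum : \sum_i p i = 1).
Context (x_le : forall i, bform 1%:M (x i) (x i) <= L) (L_gt0 : 0 < L).
Context (c_gt0 : (0 < c)%N).
Context (sum_outer : \sum_i p i *: ((x i)^T *m x i) = (c%:R^-1)%:M).

Definition low_eigenvalue (A : 'M[R]_m) : bool :=
  `[< exists2 a, eigenvalue A a & a < 1 - eps >].

(** Markov's inequality for tr (1 - h G)^K, starting from tr 1 = m. *)
Lemma sum_low_eigenvalue_le (h b r : R) (s : nat) :
  0 <= h -> 0 < b -> 0 <= r -> b + c%:R * (h * L) <= 1 -> h * (1 - eps) < 1 ->
  h * 'C(s.*2.+2, 2)%:R * L <= b * s.*2.+2%:R ->
  1 - c%:R^-1 * (h * s.*2.+2%:R - h ^+ 2 * 'C(s.*2.+2, 2)%:R * L / b) <= r ->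
  \sum_(f : {ffun 'I_c -> 'I_n} |
         low_eigenvalue (\sum_j (x (f j))^T *m x (f j))) \prod_j p (f j) <=
  m%:R * r ^+ c / (1 - h * (1 - eps)) ^+ s.*2.+2.
Proof.
move=> h_ge0 b_gt0 r_ge0 b_le h_lt hC hr.
have thr_gt0 : 0 < (1 - h * (1 - eps)) ^+ s.*2.+2 by rewrite exprn_gt0 // subr_gt0.
have c_inv_ge0 : 0 <= c%:R^-1 :> R by rewrite invr_ge0 ler0n.
have one_ge (y : 'rV[R]_m) :
    (b + c%:R * (h * L)) * bform 1%:M y y <= bform 1%:M y y.
  by rewrite ler_piMl //; exact: psd1.2.
have := expected_mxtrace_exp_le p_ge0 p_sum x_le sum_outer c_inv_ge0 h_ge0 b_gt0
  (ltW L_gt0) psd1 r_ge0 (fun _ => lexx _) one_ge hC hr.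
have -> : (1%:M : 'M[R]_m) ^+ s.*2.+2 = 1%:M by exact: expr1n.
rewrite mxtrace1 ler_pdivlMr // => expected_le; apply: le_trans expected_le.
have weight_ge0 (f : {ffun 'I_c -> 'I_n}) : 0 <= \prod_j p (f j).
  by rewrite prodr_ge0.
rewrite mulr_suml big_mkcond /=; apply: ler_sum => f _.
have symG : (\sum_j (x (f j))^T *m x (f j))^T = \sum_j (x (f j))^T *m x (f j).
  by rewrite linear_sum /=; apply: eq_bigr => j _; rewrite trmx_mul trmxK.
have symB : (1%:M - h *: \sum_j (x (f j))^T *m x (f j))^T =
    1%:M - h *: \sum_j (x (f j))^T *m x (f j).
  by rewrite linearB linearZ /= trmx1 symG.
rewrite -doubleS; case: ifPn => [/asboolP [a eig_a a_lt]|_].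
  apply: ler_wpM2l => //.
  apply: le_trans (eigenvalue_exp_le_mxtrace _ h symG eig_a).
  have le_ha : 1 - h * (1 - eps) <= 1 - h * a.
    by rewrite lerD2l lerN2; apply: ler_wpM2l => //; exact: ltW.
  have thr1_ge0 : 0 <= 1 - h * (1 - eps) by rewrite subr_ge0 ltW.
  by apply: lerXn2r => //; rewrite nnegrE // (le_trans thr1_ge0).
apply: mulr_ge0 => //; rewrite mxtrace_sum_bform sumr_ge0 // => i _.
set B := 1%:M - _ in symB *.
have -> : B ^+ s.+1.*2 = B ^+ s.+1 * 1%:M * B ^+ s.+1.
  by rewrite mulr1 -exprD addnn.
by rewrite bform_sandwich_exp //; exact: psd1.2.
Qed.

(** Taking K-th powers in 1 / (1 - z) = 1 + z / (1 - z) <= exp (z / (1 - z)). *)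
Lemma expR_le_pow_sub (z : R) (K : nat) :
  z < 1 -> expR (- (K%:R * (z / (1 - z)))) <= (1 - z) ^+ K.
Proof.
move=> z_lt1; have z1_gt0 : 0 < 1 - z by rewrite subr_gt0.
rewrite -mulrN expRM_natl; apply: lerXn2r; rewrite ?nnegrE ?expR_ge0 ?(ltW z1_gt0) //.
rewrite expRN -[leRHS]invrK lef_pV2 ?posrE ?expR_gt0 ?invr_gt0 //.
apply: le_trans (expR_ge1Dx _).
suff -> : 1 + z / (1 - z) = (1 - z)^-1 by [].
by field; rewrite gt_eqF.
Qed.

(** Matrix Chernoff bound, from [sum_low_eigenvalue_le] with h = theta / K.  With
    u and z the two errors of order 1 / K, the exponent is
      theta (-1 + eps / (2 (1 - u)) + (1 - eps) / (1 - z)),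
    which tends to - eps^2 / (2 L) as K grows.  The slack between that limit and - l is
    of order theta eps^2, so K has to exceed (c + theta) / eps^2 by a constant
    factor. *)
Lemma sampled_gram_low_eigenvalue_le (l : R) :
  0 < eps < 1 -> (2 + 2 / 3 * eps) * l * L <= eps ^+ 2 ->
  \sum_(f : {ffun 'I_c -> 'I_n} |
         low_eigenvalue (\sum_j (x (f j))^T *m x (f j))) \prod_j p (f j) <=
  m%:R * expR (- l).
Proof.
move=> /andP[eps_gt0 eps_lt1] l_le.
(* The minimizer of - theta eps + theta^2 L / 2. *)
pose theta := eps / L.
have theta_gt0 : 0 < theta by rewrite divr_gt0.
have thetaL : theta * L = eps by rewrite /theta divfK // gt_eqF.
have c_ge1 : 1 <= c%:R :> R by rewrite ler1n.
have eps2_gt0 : 0 < eps ^+ 2 by rewrite exprn_gt0.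
pose s := Num.truncn ((16 * c%:R + 32 * theta) / eps ^+ 2).
pose K : R := s.*2.+2%:R.
have K_ge : (16 * c%:R + 32 * theta) / eps ^+ 2 <= K.
  have := truncnS_gt ((16 * c%:R + 32 * theta) / eps ^+ 2).
  move/ltW/le_trans; apply; rewrite ler_nat -/s -addnn.
  by rewrite ltnS leqW // leq_addr.
have K_gt0 : 0 < K by rewrite ltr0n.
have defK : s.*2.+2%:R = K by [].
(* K is made opaque so that field does not expand its numeral. *)
clearbody K.
pose u := c%:R * eps / K.
pose z := theta / K * (1 - eps).
have K_ge' : 16 * c%:R + 32 * theta <= K * eps ^+ 2 by rewrite -ler_pdivrMr.
have u_le : u <= eps ^+ 2 / 16.
  rewrite ler_pdivrMr // mulrAC ler_pdivlMr //.
  have : c%:R * eps <= c%:R by rewrite ler_piMr // ltW.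
  by lra.
have z_le : z <= eps ^+ 2 / 32.
  apply: (@le_trans _ _ (theta / K)).
    apply: ler_piMr; last by rewrite gerBl ltW.
    by rewrite divr_ge0 ?ltW.
  by rewrite ler_pdivrMr // mulrAC ler_pdivlMr //; lra.
have z_ge0 : 0 <= z by rewrite mulr_ge0 ?divr_ge0 ?(ltW theta_gt0) // ?ltW ?subr_gt0.
have u_ge0 : 0 <= u by rewrite divr_ge0 ?mulr_ge0 ?ler0n // ltW.
have eps2_le1 : eps ^+ 2 <= 1 by rewrite exprn_ile1 // ltW.
pose b := 1 - u.
have b_gt0 : 0 < b by rewrite /b; lra.
pose r := expR (- (c%:R^-1 * (theta - theta ^+ 2 * L / (2 * b)))).
have K_neq0 : K != 0 by rewrite gt_eqF.
have binK : 'C(s.*2.+2, 2)%:R = K * (K - 1) / 2 :> R.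
  have : ('C(s.*2.+2, 2)%:R * 2 = K * (K - 1) :> R).
    rewrite -natrM mulnC -mul_bin_diag bin1 natrM defK; congr (_ * _).
    by rewrite -defK -[in RHS]natr1 addrK.
  by move <-; rewrite mulfK.
apply: (@le_trans _ _ (m%:R * r ^+ c / (1 - theta / K * (1 - eps)) ^+ s.*2.+2)).
  apply: (@sum_low_eigenvalue_le _ b).
  - by rewrite divr_ge0 // ltW.
  - by [].
  - exact: expR_ge0.
  - have -> : c%:R * (theta / K * L) = u by rewrite /u -thetaL; ring.
    by rewrite /b; lra.
  - by rewrite -/z; lra.
  - rewrite binK defK.
    have -> : theta / K * (K * (K - 1) / 2) * L = eps / 2 * (K - 1).
      by rewrite -thetaL; field.
    have : eps / 2 <= b by rewrite /b; lra.
    move/(ler_wpM2r (ltW K_gt0)); apply: le_trans.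
    by apply: ler_wpM2l; rewrite ?gerBl // divr_ge0 // ltW.
  - rewrite binK defK; apply: le_trans (expR_ge1Dx _).
    rewrite lerD2l lerN2; apply: ler_wpM2l; first by rewrite invr_ge0 ler0n.
    have -> : theta / K * K = theta by rewrite divfK.
    rewrite lerD2l lerN2.
    have -> : (theta / K) ^+ 2 * (K * (K - 1) / 2) * L / b =
       theta ^+ 2 * L / (2 * b) * (1 - K^-1).
      by field; rewrite K_neq0 gt_eqF.
    apply: ler_piMr; last by rewrite gerBl invr_ge0 ltW.
    by rewrite divr_ge0 // mulr_ge0 ?sqr_ge0 // ltW.
have z1_gt0 : 0 < 1 - z by lra.
rewrite -/z -mulrA; apply: ler_wpM2l; first exact: ler0n.
rewrite ler_pdivrMr ?exprn_gt0 //.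
apply: (@le_trans _ _ (expR (- l) * expR (- (K * (z / (1 - z)))))); last first.
  apply: ler_wpM2l; first exact: expR_ge0.
  by rewrite -defK; apply: expR_le_pow_sub; lra.
rewrite -expRM_natl -expRD ler_expR mulrN mulVKf ?pnatr_eq0 -?lt0n //.
have -> : K * (z / (1 - z)) = theta * ((1 - eps) / (1 - z)).
  have Kz : K * z = theta * (1 - eps) by rewrite /z; field.
  by rewrite [LHS]mulrA Kz mulrA.
have -> : theta ^+ 2 * L / (2 * b) = theta * (eps / (2 * b)).
  by rewrite -thetaL; field; rewrite gt_eqF.
have inv_b : b^-1 <= 1 + 2 * u.
  rewrite -[_^-1]mul1r ler_pdivrMr // /b.
  suff : 0 <= u * (1 - 2 * u) by lra.
  by apply: mulr_ge0 => //; lra.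
have inv_z : (1 - z)^-1 <= 1 + 2 * z.
  rewrite -[_^-1]mul1r ler_pdivrMr //.
  suff : 0 <= z * (1 - 2 * z) by lra.
  by apply: mulr_ge0 => //; lra.
have l_le' : l <= theta * (eps / (2 + 2 / 3 * eps)).
  rewrite mulrA ler_pdivlMr; last by lra.
  rewrite -(ler_pM2r L_gt0) mulrAC [leRHS]mulrAC thetaL -expr2.
  by apply: le_trans l_le; rewrite mulrAC [l * _]mulrC mulrAC.
suff : eps / (2 + 2 / 3 * eps) <= 1 - eps / (2 * b) - (1 - eps) / (1 - z).
  by move/(ler_wpM2l (ltW theta_gt0)); lra.
have e1 : eps / (2 * b) <= eps / 2 + eps * u.
  have -> : eps / (2 * b) = eps / 2 * b^-1 by field; rewrite gt_eqF.
  have : eps / 2 * b^-1 <= eps / 2 * (1 + 2 * u) by apply: ler_wpM2l => //; lra.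
  by lra.
have e2 : (1 - eps) / (1 - z) <= 1 - eps + 2 * z.
  have : (1 - eps) / (1 - z) <= (1 - eps) * (1 + 2 * z) by apply: ler_wpM2l => //; lra.
  have : 0 <= eps * z by rewrite mulr_ge0 // ltW.
  by lra.
have e3 : eps * u <= eps ^+ 2 / 16.
  by apply: le_trans u_le; apply: ler_piMl => //; exact: ltW.
have e4 : eps / (2 + 2 / 3 * eps) <= eps / 2 - eps ^+ 2 / 8.
  rewrite ler_pdivrMr; last by lra.
  suff : 0 <= eps ^+ 2 * (1 - eps) by lra.
  by apply: mulr_ge0; lra.
by lra.
Qed.

End TailBound.

(** * Sampling probabilities and singular values *)

Section Samples.
Context {R : realType} {d : measure_display} {T : measurableType d}.
Context {P : probability T R} {n c : nat} {p : 'I_n -> R}.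
Context {t : 'I_c -> T -> 'I_n} (t_iid : iid_samples P p t).

Let outcome (w : T) : {ffun 'I_c -> 'I_n} := [ffun j => t j w].

Lemma outcome_preimage f :
  outcome @^-1` [set f] =
  \bigcap_(j in [set` [set: 'I_c]%SET]) (t j @^-1` [set f j]).
Proof.
apply/seteqP; split=> w /=.
  by move=> <- j _; rewrite /= ffunE.
by move=> tf; apply/ffunP => j; rewrite ffunE; apply: tf; rewrite /= finset.in_setT.
Qed.

(** The event is a finite disjoint union of the measurable sets on which all the
    samples are prescribed, so this covers every S. *)
Lemma probability_outcome (S : pred {ffun 'I_c -> 'I_n}) :
  P [set w | S (outcome w)] = (\sum_(f | S f) \prod_j p (f j))%:E.
Proof.
have [t_meas t_ind t_p] := t_iid.
have -> : [set w | S (outcome w)] = \bigcup_(f in [set` S]) (outcome @^-1` [set f]).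
  apply/seteqP; split=> w /= => [Sw|[f /= Sf ow]]; last by rewrite ow.
  by exists (outcome w).
rewrite measure_fin_bigcup.
- rewrite -(bigfs _ (index_enum_uniq _)) /=; last first.
    by move=> f _; rewrite mem_index_enum.
  rewrite -sumEFin; apply: eq_bigr => f _.
  rewrite outcome_preimage t_ind -prodEFin.
  by under eq_bigl do rewrite finset.in_setT; apply: eq_bigr => j _.
- exact: finite_finset.
- exact: trivIset_preimage1.
- move=> f _; rewrite outcome_preimage; apply: fin_bigcap_measurable.
    exact: finite_finset.
  by move=> j _; exact: t_meas.
Qed.

End Samples.

Lemma sum_prod_probability (R : realType) (n c : nat) (p : 'I_n -> R) :
  \sum_i p i = 1 -> \sum_(f : {ffun 'I_c -> 'I_n}) \prod_j p (f j) = 1.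
Proof.
move=> p_sum; rewrite -(bigA_distr_bigA (fun _ i => p i)) big1 // => j _.
Qed.

(** The infimum defining sigma_m is over a nonempty set by [real_eigenvalue_sym]; for
    an empty set it would be 0. *)
Lemma sqrt_le_sigma_m (R : realType) (m c : nat) (A : 'M[R]_(m, c)) (lam : R) :
  (0 < m)%N -> (forall a, eigenvalue (A *m A^T) a -> lam <= a) ->
  Num.sqrt lam <= sigma_m A.
Proof.
move=> m_gt0 lam_le; apply: ler_wsqrtr; apply: lb_le_inf; last exact: lam_le.
by apply: real_eigenvalue_sym => //; rewrite trmx_mul trmxK.
Qed.

Lemma norm2_sqr (R : realType) (m : nat) (v : 'cV[R]_m) :
  norm2 v ^+ 2 = \sum_i v i 0 ^+ 2.
Proof. by rewrite sqr_sqrtr // sumr_ge0 // => i _; exact: sqr_ge0. Qed.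

(** Valid also at indices with p i = 0, where both sides use 0^-1 = 0. *)
Lemma sampling_gramE (R : realType) (m n c : nat) (Q : 'M[R]_(m, n))
    (p : 'I_n -> R) (f : 'I_c -> 'I_n) :
  let x i := (Num.sqrt (c%:R * p i))^-1 *: (col i Q)^T in
  Q *m sampling_mx p f *m (Q *m sampling_mx p f)^T =
  \sum_j (x (f j))^T *m x (f j).
Proof.
move=> x; apply/matrixP => k l; rewrite [LHS]mxE summxE; apply: eq_bigr => j _.
have QS k' : (Q *m sampling_mx p f) k' j = x (f j) 0 k'.
  rewrite !mxE (bigD1 (f j)) //= big1 => [|i i_neq]; rewrite !mxE.
    by rewrite eqxx addr0 mul1r mulrC.
  by rewrite (negbTE i_neq) mul0r mulr0.
by rewrite [in LHS](mxE _ _ j l) [RHS]mxE big_ord1 [in RHS](mxE _ _ k 0) !QS.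
Qed.

(** Common form of the two sampling schemes: the squared column norms are at most
    ell times the probabilities.  Summing this over the columns gives m <= ell. *)
Lemma sampling_sigma_m_ge (R : realType) (m n c : nat) (Q : 'M[R]_(m, n))
    (p : 'I_n -> R) (d : measure_display) (T : measurableType d)
    (P : probability T R) (t : 'I_c -> T -> 'I_n) (ell eps delta : R) :
  (0 < m)%N -> (0 < c)%N -> Q *m Q^T = 1%:M -> probability_vector p ->
  iid_samples P p t -> 0 < eps < 1 -> 0 < delta ->
  (forall i, norm2 (col i Q) ^+ 2 <= ell * p i) ->
  c0 eps * ell * (ln (m%:R / delta) / eps ^+ 2) <= c%:R ->
  ((1 - delta)%:E <=
    P [set w | (Num.sqrt (1 - eps) <=
                sigma_m (Q *m sampling_mx p (fun j => t j w)))%R])%E.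
Proof.
move=> m_gt0 c_gt0 QQ [p_ge0 p_sum] t_iid eps01 delta_gt0 leverage_le c_ge.
have [eps_gt0 eps_lt1] := andP eps01.
have mR_gt0 : 0 < m%:R :> R by rewrite ltr0n.
have cR_gt0 : 0 < c%:R :> R by rewrite ltr0n.
have sum_norm2 : \sum_i norm2 (col i Q) ^+ 2 = m%:R.
  rewrite -(mxtrace1 R m) -QQ; under eq_bigr do rewrite norm2_sqr.
  rewrite exchange_big /mxtrace; apply: eq_bigr => k _.
  by rewrite mxE; apply: eq_bigr => i _; rewrite !mxE expr2.
have ell_gt0 : 0 < ell.
  apply: lt_le_trans mR_gt0 _; rewrite -sum_norm2 -[ell]mulr1 -p_sum mulr_sumr.
  by apply: ler_sum => i _; exact: leverage_le.
pose x i := (Num.sqrt (c%:R * p i))^-1 *: (col i Q)^T.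
have x_outer i : p i *: ((x i)^T *m x i) = c%:R^-1 *: (col i Q *m (col i Q)^T).
  have [pi0|pi_neq0] := eqVneq (p i) 0.
    (* An index of probability 0 belongs to a zero column. *)
  have /eqP : norm2 (col i Q) ^+ 2 = 0.
      apply/eqP; rewrite eq_le sqr_ge0 andbT.
      by have := leverage_le i; rewrite pi0 mulr0.
    rewrite norm2_sqr psumr_eq0 => [/allP col0|k _]; last exact: sqr_ge0.
    have -> : col i Q = 0.
      apply/colP => k; rewrite [RHS]mxE; apply/eqP; rewrite -sqrf_eq0.
      by apply: col0; rewrite mem_index_enum.
    by rewrite pi0 scale0r mul0mx scaler0.
  have pc_ge0 : 0 <= c%:R * p i by rewrite mulr_ge0 // ltW.
  have -> : (x i)^T = (Num.sqrt (c%:R * p i))^-1 *: col i Q.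
    by apply/matrixP => k l; rewrite !mxE.
  rewrite /x -scalemxAl -scalemxAr !scalerA; congr (_ *: _).
  rewrite -mulrA -invfM -expr2 sqr_sqrtr //.
  by field; rewrite pi_neq0 gt_eqF.
have x_le i : bform 1%:M (x i) (x i) <= ell / c%:R.
  have -> : bform 1%:M (x i) (x i) = (c%:R * p i)^-1 * norm2 (col i Q) ^+ 2.
    rewrite /x bformZl bformZr mulrA -invfM -expr2 sqr_sqrtr; last first.
      by rewrite mulr_ge0 // ltW.
    congr (_ * _); rewrite norm2_sqr bform1_sumsq.
    by apply: eq_bigr => k _; rewrite mxE.
  have [->|pi_neq0] := eqVneq (p i) 0.
    by rewrite mulr0 invr0 mul0r divr_ge0 // ltW.
  have pi_gt0 : 0 < p i by rewrite lt_neqAle eq_sym pi_neq0 /=.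
  rewrite ler_pdivrMl ?mulr_gt0 //.
  suff -> : c%:R * p i * (ell / c%:R) = ell * p i by [].
  by field; rewrite gt_eqF.
have sum_outer : \sum_i p i *: ((x i)^T *m x i) = (c%:R^-1)%:M.
  under eq_bigr do rewrite x_outer.
  rewrite -scaler_sumr -scalemx1 -QQ; congr (_ *: _).
  apply/matrixP => k l; rewrite summxE mxE; apply: eq_bigr => i _.
  by rewrite !mxE big_ord1 !mxE.
have l_le : (2 + 2 / 3 * eps) * ln (m%:R / delta) * (ell / c%:R) <= eps ^+ 2.
  have eps2_gt0 : 0 < eps ^+ 2 by rewrite exprn_gt0.
  rewrite mulrA ler_pdivrMr // [leRHS]mulrC -ler_pdivrMr //.
  by apply: le_trans c_ge; rewrite /c0 le_eqVlt; apply/orP; left; apply/eqP; ring.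
have tail := sampled_gram_low_eigenvalue_le p_ge0 p_sum x_le
  (divr_gt0 ell_gt0 cR_gt0) c_gt0 sum_outer eps01 l_le.
have md : m%:R * expR (- ln (m%:R / delta)) = delta.
  by rewrite expRN lnK ?posrE ?divr_gt0 // invf_div mulrCA divff ?mulr1 // gt_eqF.
rewrite md in tail.
pose good (f : {ffun 'I_c -> 'I_n}) :=
  Num.sqrt (1 - eps) <= sigma_m (Q *m sampling_mx p f).
have -> : [set w | Num.sqrt (1 - eps) <= sigma_m (Q *m sampling_mx p (fun j => t j w))]
    = [set w | good [ffun j => t j w]].
  apply/funext => w /=; rewrite /good; congr (is_true (_ <= sigma_m (_ *m _))).
  by apply/matrixP => i j; rewrite !mxE ffunE.
rewrite (probability_outcome t_iid) lee_fin lerBlDr.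
have := sum_prod_probability c p_sum; rewrite (bigID good) /= => total.
rewrite -[leLHS]total lerD2l.
apply: le_trans tail; rewrite big_mkcond [leRHS]big_mkcond /=.
apply: ler_sum => f _; have w_ge0 : 0 <= \prod_j p (f j) by rewrite prodr_ge0.
case: ifPn => [bad_f|_]; last by case: ifP.
rewrite ifT //; apply: contraNT bad_f => /asboolPn no_low.
apply: sqrt_le_sigma_m => // a; rewrite (sampling_gramE Q p f) => eig_a.
by rewrite leNgt; apply/negP => a_lt; apply: no_low; exists a.
Qed.

Theorem theorem6p1 (R : realType) (m n c : nat) (Q : 'M[R]_(m, n))
    (p : 'I_n -> R) (d : measure_display) (T : measurableType d)
    (P : probability T R) (t : 'I_c -> T -> 'I_n) (eps delta : R)
    (m_gt0 : (0 < m)%N)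
    (c_bounds : (1 <= c <= n)%N)
    (orthonormal_rows : Q *m Q^T = 1%:M)
    (p_prob : probability_vector p)
    (t_iid : iid_samples P p t)
    (eps_bounds : 0 < eps < 1)
    (delta_bounds : 0 < delta < 1)
    (sampling :
      (exists beta : R,
        [/\ 0 < beta <= 1,
            nearly_optimal Q beta p &
            c0 eps * m%:R * (ln (m%:R / delta) / (beta * eps ^+ 2)) <= c%:R])
      \/
      ((forall j, p j = 1 / n%:R) /\
       c0 eps * n%:R * coherence Q * (ln (m%:R / delta) / eps ^+ 2) <= c%:R)) :
  ((1 - delta)%:E <=
    P [set w | (Num.sqrt (1 - eps) <=
                sigma_m (Q *m sampling_mx p (fun j => t j w)))%R])%E.
Proof.
have /andP[c_gt0 c_le_n] := c_bounds; have /andP[delta_gt0 _] := delta_bounds.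
have n_gt0 : 0 < n%:R :> R by rewrite ltr0n (leq_trans c_gt0).
have mR_gt0 : 0 < m%:R :> R by rewrite ltr0n.
(* The ratio ell is m / beta in the first case, n * coherence Q in the second. *)
case: sampling => [[beta [/andP[beta_gt0 _] opt c_ge]]|[p_unif c_ge]].
  have normQ : normF Q ^+ 2 = m%:R.
    rewrite sqr_sqrtr; last first.
      by apply: sumr_ge0 => k _; apply: sumr_ge0 => j _; exact: sqr_ge0.
    rewrite -(mxtrace1 R m) -orthonormal_rows; apply: eq_bigr => k _.
    by rewrite mxE; apply: eq_bigr => i _; rewrite !mxE expr2.
  apply: (@sampling_sigma_m_ge _ _ _ _ _ _ _ _ _ _ (m%:R / beta)) => //.
    move=> i; have := opt i; rewrite normQ mulrA ler_pdivrMr // => le_pm.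
    rewrite mulrAC ler_pdivlMr // mulrC [leRHS]mulrC; exact: le_pm.
  apply: le_trans c_ge; rewrite le_eqVlt; apply/orP; left; apply/eqP.
  by field; rewrite !gt_eqF //; case/andP: eps_bounds.
apply: (@sampling_sigma_m_ge _ _ _ _ _ _ _ _ _ _ (n%:R * coherence Q)) => //.
  move=> i; rewrite p_unif mul1r mulrAC divff ?mul1r ?gt_eqF //.
  exact: (le_bigmax _ (fun j => norm2 (col j Q) ^+ 2)).
by rewrite (mulrA (c0 eps)).
Qed.
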